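(* Let $\mathcal A$ be an arbitrary associative algebra and let $X$ be an infinite-dimensional Banach space. Let $C \in \mathcal B(X)$ be a fixed operator of finite rank $k$ and let $D \in \mathcal A$ be a fixed element. If $\phi: \mathcal B(X) \to \mathcal A$ is an additive map such that $\phi(A)\phi(B) = D$ whenever $A, B \in \mathcal B(X)$ satisfy $AB = C$, then $\phi$ preserves the zero product, that is, $\phi(Q)\phi(P) = 0$ whenever $Q, P \in \mathcal B(X)$ satisfy $QP = 0$.
   Context: $X$ is a complex Banach space and $\mathcal B(X)$ is the algebra of bounded linear operators on $X$. The map $\phi$ is only assumed additive (not linear, continuous, injective or surjective). *)

(* Defs.v *)
From HB Require Import structures.
From mathcomp Require Import all_boot all_order all_algebra.
From mathcomp Require Export complex.
From mathcomp Require Import all_classical all_reals all_analysis.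

Set Implicit Arguments.
Unset Strict Implicit.
Unset Printing Implicit Defensive.

Import Order.TTheory GRing.Theory Num.Theory.
Import numFieldNormedType.Exports.

Local Open Scope classical_set_scope.
Local Open Scope ring_scope.

(* The order on K = R[i] is partial, `|x| is a nonnegative real of K, and the
   inequality forces M to be real and nonnegative as soon as X <> 0. *)
Definition is_bounded_linear (K : numFieldType) (X : normedModType K) :
    {pred X -> X} :=
  fun f => `[< linear f /\ exists M : K, forall x, `|f x| <= M * `|x| >].

Section bounded_linear_closed.
Context {K : numFieldType} {X : normedModType K}.
Implicit Types f g : X -> X.

Lemma is_bounded_linearP f :
  reflect (linear f /\ exists M : K, forall x, `|f x| <= M * `|x|)
          (f \in @is_bounded_linear K X).
Proof. exact: asboolP. Qed.

Lemma is_bounded_linear_submod_closed : submod_closed (@is_bounded_linear K X).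
Proof.
split.
  apply/is_bounded_linearP; split; first by move=> a x y; rewrite scaler0 addr0.
  by exists 0 => x; rewrite normr0 mul0r.
move=> a f g /is_bounded_linearP[lf [M fM]] /is_bounded_linearP[lg [N gN]].
apply/is_bounded_linearP; split.
  move=> b x y; rewrite !fctE /= lf lg !scalerDr !scalerA (mulrC a b).
  by rewrite -!addrA; congr (_ + _); rewrite addrCA.
exists (`|a| * M + N) => x; rewrite !fctE /= mulrDl.
apply: le_trans (ler_normD _ _) _; apply: lerD => //.
by rewrite normrZ -mulrA ler_wpM2l.
Qed.

HB.instance Definition _ := GRing.isSubmodClosed.Build K (X -> X)
  (@is_bounded_linear K X)
  is_bounded_linear_submod_closed.

Lemma is_bounded_linear_id : @idfun X \in @is_bounded_linear K X.
Proof.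
by apply/is_bounded_linearP; split=> //; exists 1 => x; rewrite mul1r.
Qed.

Lemma is_bounded_linear_comp f g :
  f \in @is_bounded_linear K X -> g \in @is_bounded_linear K X ->
  f \o g \in @is_bounded_linear K X.
Proof.
move=> /is_bounded_linearP[lf [M fM]] /is_bounded_linearP[lg [N gN]].
apply/is_bounded_linearP; split; first by move=> a x y /=; rewrite lg lf.
exists (`|M| * N) => x /=.
have [->|x0] := eqVneq x 0.
  have g0 : g 0 = 0 by have := lg (-1) 0 0; rewrite !scaleN1r !addNr.
  have f0 : f 0 = 0 by have := lf (-1) 0 0; rewrite !scaleN1r !addNr.
  by rewrite g0 f0 normr0 mulr0.
apply: le_trans (fM _) _; rewrite -mulrA.
apply: le_trans (_ : `|M| * `|g x| <= _); last by rewrite ler_wpM2l.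
apply: ler_wpM2r => //; apply: real_ler_norm.
have Mx : 0 <= M * `|x| by apply: le_trans (fM x).
by rewrite ger0_real // -(pmulr_lge0 _ (_ : 0 < `|x|)) ?normr_gt0.
Qed.

End bounded_linear_closed.

Record boundedOp (K : numFieldType) (X : normedModType K) := BoundedOp {
  boundedOp_fun :> X -> X;
  _ : boundedOp_fun \in @is_bounded_linear K X }.

Section boundedOp_algebra.
Context {K : numFieldType} {X : normedModType K}.

HB.instance Definition _ := [isSub for @boundedOp_fun K X].
HB.instance Definition _ := [Choice of boundedOp X by <:].
HB.instance Definition _ := [SubChoice_isSubLmodule of boundedOp X by <:].

Implicit Types f g h : boundedOp X.

Lemma boundedOp_linear f : linear f.
Proof. by have /is_bounded_linearP[] := valP f. Qed.

HB.instance Definition _ f :=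
  GRing.isLinear.Build K X X *:%R (boundedOp_fun f) (boundedOp_linear f).

Definition boundedOp_one : boundedOp X := BoundedOp is_bounded_linear_id.

Definition boundedOp_mul f g : boundedOp X :=
  BoundedOp (is_bounded_linear_comp (valP f) (valP g)).

Let mulA : associative boundedOp_mul.
Proof. by move=> f g h; apply/val_inj. Qed.

Let mul1 : left_id boundedOp_one boundedOp_mul.
Proof. by move=> f; apply/val_inj. Qed.

Let mulr1 : right_id boundedOp_one boundedOp_mul.
Proof. by move=> f; apply/val_inj. Qed.

Let mulDl : left_distributive boundedOp_mul +%R.
Proof. by move=> f g h; apply/val_inj. Qed.

Let mulDr : right_distributive boundedOp_mul +%R.
Proof.
by move=> f g h; apply/val_inj/funext => x /=; rewrite !fctE /= linearD.
Qed.

HB.instance Definition _ := GRing.Zmodule_isPzRing.Build (boundedOp X)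
  mulA mul1 mulr1 mulDl mulDr.

Lemma boundedOp_mulE f g x : (f * g) x = f (g x).
Proof. by []. Qed.

Lemma boundedOp_addE f g x : (f + g) x = f x + g x.
Proof. by []. Qed.

Lemma boundedOp_scaleE (a : K) f x : (a *: f) x = a *: f x.
Proof. by []. Qed.

(* The two compatibilities making boundedOp X an algebra; algType is not
   instantiated because it requires 1 != 0. *)
Lemma boundedOp_scaleAl (a : K) f g : a *: (f * g) = (a *: f) * g.
Proof. exact/val_inj. Qed.

Lemma boundedOp_scaleAr (a : K) f g : a *: (f * g) = f * (a *: g).
Proof.
apply/val_inj/funext => x.
by rewrite -[LHS]/(a *: f (g x)) -[RHS]/(f (a *: g x)) linearZ.
Qed.

End boundedOp_algebra.

(* vector.v only covers types that are finite-dimensional by construction. *)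
Definition has_dim (K : fieldType) (V : lmodType K) (S : set V) (n : nat) :=
  exists e : 'I_n -> V,
    (forall a : 'I_n -> K, \sum_(i < n) a i *: e i = 0 -> forall i, a i = 0) /\
    S = range (fun a : 'I_n -> K => \sum_(i < n) a i *: e i).

Definition infinite_dimensional (K : fieldType) (V : lmodType K) :=
  ~ exists n, has_dim [set: V] n.

Definition has_rank (K : numFieldType) (X : normedModType K)
  (T : boundedOp X) (k : nat) := has_dim (range T) k.

(* Main.v *)
From HB Require Import structures.
Require Import Defs.
From mathcomp Require Import all_boot all_order all_algebra.
From mathcomp Require Import all_classical all_reals all_analysis.
From mathcomp Require Import ring lra.
Import Order.TTheory GRing.Theory Num.Theory.
Import numFieldNormedType.Exports.
Set Implicit Arguments.
Unset Strict Implicit.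
Unset Printing Implicit Defensive.
Local Open Scope classical_set_scope.
Local Open Scope ring_scope.

(** The starting point is that a factorization S T = C with S P = 0 and Q T = 0
    survives the perturbations S + Q of S and T + P of T. Comparing the value D
    of the product on the four resulting factorizations of C and cancelling
    leaves phi(Q) phi(P) = 0 ([zero_product_of_factorization]).

    Such S and T exist as soon as there are as many vectors u_i in ker Q and
    continuous functionals f_i vanishing on ran P, dual to each other, as it
    takes vectors e_i to span the range of C: with C = sum_i e_i (x) c_i, let S
    be sum_i e_i (x) f_i and T be sum_i u_i (x) c_i
    ([zero_product_of_biorthogonal]).

    They need not exist for nonzero C: if P is idempotent and Q = 1 - P, every
    functional vanishing on ran P vanishes on ker Q = ran P. But phi is
    additive, so Q or P may be cut into two pieces, and 2n pairs, with n the
    number of the e_i, are then enough when only one of the two constraints is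
    met. If the f_i vanish on ran P, let E be the
    finite-rank idempotent built on the first n pairs: Q (1 - E) kills the first
    n vectors and Q E kills the last n ([zero_product_of_annihilators]). If
    instead the u_i lie in ker Q, then (1 - E) P is annihilated by the first n
    functionals and E P by the last n ([zero_product_of_kernel]).

    One of the two situations always occurs. If Q has rank at least 2n, choose
    functionals g_i dual to vectors Q x_i; then the functionals g_i o Q are dual
    to the x_i and vanish on ran P because Q P = 0. Otherwise Q has finite rank,
    so ker Q has finite codimension in the infinite-dimensional space X and
    contains 2n independent vectors, for which dual functionals exist.

    Dual continuous functionals come from the Hahn-Banach theorem, which is
    obtained here without extending functionals from subspaces: a minimal
    sublinear functional is linear. *)

(** * The Hahn-Banach theorem *)

Section sublinear.
Context {R : realType} {V : lmodType R}.
Implicit Types (p q : V -> R) (x y : V) (t : R).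

(** The inequality in the second clause is an equality by [sublinearZ]; asking
    for less keeps the verification of sublinearity short. *)
Definition sublinear p :=
  (forall x y, p (x + y) <= p x + p y) /\
  (forall t x, 0 <= t -> p (t *: x) <= t * p x).

Lemma sublinear0 p : sublinear p -> p 0 = 0.
Proof.
move=> [pD pZ]; apply/eqP; rewrite eq_le; apply/andP; split.
  by have := pZ 0 0 (lexx _); rewrite scale0r mul0r.
by have := pD 0 0; rewrite addr0; lra.
Qed.

Lemma sublinearZ p t x : sublinear p -> 0 <= t -> p (t *: x) = t * p x.
Proof.
move=> sp; rewrite le_eqVlt => /predU1P[<-|t0].
  by rewrite scale0r mul0r sublinear0.
have [_ pZ] := sp; apply/eqP; rewrite eq_le pZ ?(ltW t0)//=.
rewrite -ler_pdivlMl// -[in leLHS](scalerK (lt0r_neq0 t0) x).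
by apply: pZ; rewrite invr_ge0 ltW.
Qed.

Lemma sublinearN_ge p x : sublinear p -> - p (- x) <= p x.
Proof.
by move=> sp; have := sp.1 x (- x); rewrite subrr sublinear0//; lra.
Qed.

(** The largest sublinear functional below [p] whose value at [- y] is at most
    [- p y]. Every linear minorant of [p] that agrees with [p] at [y] lies below
    it. *)
Definition descend p y x :=
  inf [set p (x + t *: y) - t * p y | t in [set t | 0 <= t]].

Lemma descend_le p y x t : sublinear p -> 0 <= t ->
  descend p y x <= p (x + t *: y) - t * p y.
Proof.
move=> sp t0; apply: ge_inf; last by exists t.
exists (- p (- x)) => _ [s s0 <-].
have := sp.1 (x + s *: y) (- x).
by rewrite (addrC x) addrK sublinearZ//; lra.
Qed.

Lemma le_descend p y x m :
  (forall t, 0 <= t -> m <= p (x + t *: y) - t * p y) -> m <= descend p y x.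
Proof.
move=> mp; apply: lb_le_inf.
  by exists (p (x + 0 *: y) - 0 * p y); exists 0 => //=.
by move=> _ [t t0 <-]; exact: mp.
Qed.

Lemma descend_le_self p y x : sublinear p -> descend p y x <= p x.
Proof.
move=> sp; have := descend_le y x sp (lexx 0).
by rewrite scale0r addr0 mul0r subr0.
Qed.

Lemma descend_sublinear p y : sublinear p -> sublinear (descend p y).
Proof.
move=> sp; split=> [x1 x2|s x].
  rewrite -lerBlDr; apply: le_descend => t1 t10.
  rewrite lerBlDr -lerBlDl; apply: le_descend => t2 t20; rewrite lerBlDl.
  apply: le_trans (descend_le y _ sp (addr_ge0 t10 t20)) _.
  have := sp.1 (x1 + t1 *: y) (x2 + t2 *: y).
  by rewrite addrACA -scalerDl; lra.
rewrite le_eqVlt => /predU1P[<-|s0].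
  have := descend_le_self y (0 *: x) sp.
  by rewrite scale0r mul0r (sublinear0 sp).
rewrite -ler_pdivrMl//; apply: le_descend => t t0; rewrite ler_pdivrMl//.
apply: le_trans (descend_le y _ sp (mulr_ge0 (ltW s0) t0)) _.
by rewrite -scalerA -scalerDr sublinearZ ?(ltW s0)// mulrBr mulrA.
Qed.

Lemma descendN_le p y : sublinear p -> descend p y (- y) <= - p y.
Proof.
move=> sp; have := descend_le y (- y) sp ler01.
by rewrite scale1r addNr sublinear0// mul1r sub0r.
Qed.

(** The infimum is finite because a sublinear minorant [r] of [p] satisfies
    [- p (- x) <= - r (- x) <= r x]; it is subadditive because of two members of
    a chain the smaller one bounds both terms of the sum. *)
Lemma inf_chain_sublinear p (A : set (V -> R)) : sublinear p -> A !=set0 ->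
  (forall q, A q -> sublinear q /\ forall x, q x <= p x) ->
  (forall q r, A q -> A r ->
     (forall x, q x <= r x) \/ (forall x, r x <= q x)) ->
  exists q, [/\ sublinear q, forall x, q x <= p x &
    forall r, A r -> forall x, q x <= r x].
Proof.
move=> sp [r0 Ar0] Ap chainA.
pose q x := inf [set r x | r in A].
have q_le r x : A r -> q x <= r x.
  move=> Ar; apply: ge_inf; last by exists r.
  exists (- p (- x)) => _ [s As <-].
  have [ss sp'] := Ap _ As.
  by apply: le_trans (sublinearN_ge x ss); rewrite lerN2.
have le_q m x : (forall r, A r -> m <= r x) -> m <= q x.
  move=> mA; apply: lb_le_inf; first by exists (r0 x), r0.
  by move=> _ [r Ar <-]; exact: mA.
exists q; split=> [|x|r Ar x]; last exact: q_le.
  split=> [x y|t x].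
    rewrite -lerBlDr; apply: (le_q) => r Ar; rewrite lerBlDr -lerBlDl.
    apply: (le_q) => s As; rewrite lerBlDl.
    have [rs|sr] := chainA r s Ar As.
      apply: le_trans (q_le _ _ Ar) _.
      by apply: le_trans ((Ap _ Ar).1.1 _ _) _; rewrite lerD2l.
    apply: le_trans (q_le _ _ As) _.
    by apply: le_trans ((Ap _ As).1.1 _ _) _; rewrite lerD2r.
  rewrite le_eqVlt => /predU1P[<-|t0].
    rewrite scale0r mul0r; apply: le_trans (q_le _ _ Ar0) _.
    by rewrite sublinear0//; exact: (Ap _ Ar0).1.
  rewrite -ler_pdivrMl//; apply: (le_q) => r Ar; rewrite ler_pdivrMl//.
  by apply: le_trans (q_le _ _ Ar) _; apply: (Ap _ Ar).1.2; exact: ltW.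
by apply: le_trans (q_le _ _ Ar0) _; exact: (Ap _ Ar0).2.
Qed.

(** Zorn's lemma on the sublinear functionals below [p], ordered by [>=]. *)
Lemma minimal_sublinear p : sublinear p ->
  exists q, [/\ sublinear q, forall x, q x <= p x &
    forall r, sublinear r -> (forall x, r x <= q x) -> r = q].
Proof.
move=> sp; pose T := {q | sublinear q /\ forall x, q x <= p x}.
pose below (q r : T) := `[< forall x, sval r x <= sval q x >].
have [||||[q [sq qp]] qmin] := @Zorn T below.
- by move=> q; apply/asboolP.
- move=> q r s /asboolP rq /asboolP sr.
  by apply/asboolP => x; apply: le_trans (rq x).
- move=> [q ?] [r ?] /asboolP/= rq /asboolP/= qr; apply: eq_exist.
  by apply/funext => x; apply/le_anti; rewrite rq qr.
- move=> A Atot; have [->|/set0P[q0 Aq0]] := eqVneq A set0.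
    by exists (exist _ p (conj sp (fun=> lexx _))).
  have [|||q [sq qp qA]] := @inf_chain_sublinear p [set sval r | r in A] sp.
  + by exists (sval q0), q0.
  + by move=> _ [r Ar <-]; exact: svalP r.
  + move=> _ _ [r Ar <-] [s As <-].
    by have [/asboolP|/asboolP] := Atot _ _ Ar As; [right|left].
  exists (exist _ q (conj sq qp)) => r Ar; apply/asboolP => x /=.
  by apply: qA; exists r.
exists q; split=> // r sr rq.
have rp x : r x <= p x by exact: le_trans (rq x) (qp x).
by have /(congr1 sval) := qmin (exist _ r (conj sr rp)) (asboolT rq).
Qed.

(** A minimal sublinear functional [f] equals [descend f x] for every [x], hence
    is odd, hence linear. Starting from [descend p y] rather than [p] forces
    [f (- y) <= - p y], that is [f y >= p y]. *)
Theorem hahn_banach p y : sublinear p ->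
  exists f : V -> R, [/\ scalar f, forall x, f x <= p x & f y = p y].
Proof.
move=> sp.
have [f [sf fp fmin]] := minimal_sublinear (descend_sublinear y sp).
have fN x : f (- x) = - f x.
  apply/le_anti/andP; split.
    have fE : descend f x = f.
      apply: fmin => [|z]; first exact: descend_sublinear.
      exact: descend_le_self.
    by rewrite -[in leLHS]fE descendN_le.
  by rewrite -[x in leLHS]opprK lerNl opprK; exact: sublinearN_ge.
have fD x z : f (x + z) = f x + f z.
  apply/le_anti/andP; split; first exact: sf.1.
  by have := sf.1 (x + z) (- z); rewrite addrK fN; lra.
have fZ t x : f (t *: x) = t * f x.
  have [t0|t0] := leP 0 t; first exact: sublinearZ.
  have /(sublinearZ x sf) : 0 <= - t by rewrite oppr_ge0 ltW.
  by rewrite scaleNr fN mulNr => /oppr_inj.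
exists f; split=> [t x z|x|]; first by rewrite fD fZ.
  by exact: le_trans (fp x) (descend_le_self _ _ sp).
apply/le_anti/andP; split.
  by apply: le_trans (fp y) _; exact: descend_le_self.
have := le_trans (fp (- y)) (descendN_le y sp).
by rewrite fN lerN2.
Qed.

End sublinear.

(** * Continuous functionals on complex normed spaces *)

(** An alias, so that the real and the complex scalings do not compete on one
    type. *)
Definition realified (R : realType) (X : lmodType R[i]) : Type := X.

Section realified.
Context {R : realType} {X : lmodType R[i]}.
Local Open Scope complex_scope.

HB.instance Definition _ := GRing.Zmodule.on (realified X).

Definition real_scale (t : R) (x : realified X) : realified X :=
  t%:C *: (x : X).

Let real_scaleA a b x : real_scale a (real_scale b x) = real_scale (a * b) x.
Proof. by rewrite /real_scale scalerA rmorphM. Qed.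

Let real_scale1 : left_id 1 real_scale.
Proof. by move=> x; rewrite /real_scale rmorph1 scale1r. Qed.

Let real_scaleDr : right_distributive real_scale +%R.
Proof. by move=> t x y; rewrite /real_scale -scalerDr. Qed.

Let real_scaleDl x : {morph real_scale^~ x : a b / a + b}.
Proof. by move=> a b; rewrite /real_scale rmorphD scalerDl. Qed.

HB.instance Definition _ := GRing.Zmodule_isLmodule.Build R (realified X)
  real_scaleA real_scale1 real_scaleDr real_scaleDl.

End realified.

Section functional.
Context {K : numFieldType} {X : normedModType K}.

Record functional := Functional {
  functional_fun :> X -> K;
  functional_scalar : scalar functional_fun;
  functional_bounded : exists M, forall x, `|functional_fun x| <= M * `|x| }.

End functional.
Arguments functional {K} X.

Section complex_functional.
Context {R : realType} {X : normedModType R[i]}.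
Local Open Scope complex_scope.

(** A real-linear functional [f] dominated by the norm and attaining it at [u]
    is the real part of the complex functional sending [x] to
    [f x - i f (i x)], which is therefore nonzero at [u] and can be
    normalized. *)
Lemma norming_functional (u : X) : u != 0 -> exists f : functional X, f u = 1.
Proof.
move=> u0.
pose p (x : realified X) : R := complex.Re `|x : X|.
have pE x : (p x)%:C = `|x : X|.
  rewrite /p; apply/eqP; rewrite eq_complex /=; apply/andP; split=> //.
  by have := normr_ge0 (x : X); rewrite lecE => /andP[]; rewrite eq_sym.
have sp : sublinear p.
  split=> [x y|t x t0]; first by rewrite -lecR rmorphD/= !pE ler_normD.
  by rewrite -lecR rmorphM/= !pE normrZ ger0_norm ?ler0c.
have [f [fs fp fu]] := @hahn_banach R (realified X) p u sp.
have fD x y : f (x + y) = f x + f y.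
  by have := fs 1 x y; rewrite scale1r mul1r.
have f0 : f 0 = 0 by apply: (addIr (f 0)); rewrite -fD !add0r.
have fZ t (x : X) : f (t%:C *: x) = t * f x.
  by have := fs t x 0; rewrite addr0 f0 addr0.
have f_le x : `|f x| <= p x.
  rewrite ler_norml fp andbT lerNl -mulN1r -fZ.
  by rewrite (le_trans (fp _))// rmorphN1 scaleN1r /p normrN.
pose g (x : X) : R[i] := f x -i* f ('i *: x).
have gs : scalar g.
  move=> [s t] x y; rewrite /g.
  have aE : (s +i* t) *: x = s%:C *: x + t%:C *: ('i *: x).
    by rewrite scalerA -scalerDl; congr (_ *: _); simpc.
  have iaE : 'i *: ((s +i* t) *: x) = s%:C *: ('i *: x) + (- t)%:C *: x.
    by rewrite !scalerA -scalerDl; congr (_ *: _); simpc.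
  rewrite scalerDr iaE aE !fD !fZ; simpc.
  by congr (_ +i* _); ring.
have norm_real (a : R) : `|a%:C| = `|a|%:C.
  by rewrite normc_def /= expr0n addr0 sqrtr_sqr.
have norm_i : `|'i : R[i]| = 1.
  by rewrite normc_def /= expr0n expr1n add0r sqrtr1.
have g_le x : `|g x| <= 2 * `|x|.
  rewrite (complexE (g x)) (le_trans (ler_normD _ _))// normrM norm_i mul1r.
  rewrite !norm_real normrN mulr_natl mulr2n lerD//.
    by rewrite -pE lecR; exact: f_le.
  by rewrite -(mul1r `|x|) -norm_i -normrZ -pE lecR; exact: f_le.
have gu0 : g u != 0.
  rewrite eq_complex negb_and /= fu; apply/orP; left.
  by apply: contra u0 => /eqP pu; rewrite -normr_eq0 -pE pu.
have hs : scalar (fun x => (g u)^-1 * g x) by move=> a x y; rewrite gs; ring.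
have hM : exists M, forall x, `|(g u)^-1 * g x| <= M * `|x|.
  exists (`|(g u)^-1| * 2) => x.
  by rewrite normrM -mulrA ler_wpM2l.
by exists (Functional hs hM); rewrite /= mulVf.
Qed.

End complex_functional.

(** * Finite-rank operators and biorthogonal systems *)

Section finite_rank.
Context {K : numFieldType} {X : normedModType K}.
Implicit Types (f g : functional X) (S T : boundedOp X) (x y : X).

HB.instance Definition _ f :=
  GRing.isLinear.Build K X K *%R (functional_fun f) (functional_scalar f).

Lemma boundedOp_ext S T : (forall x, S x = T x) -> S = T.
Proof. by move=> ST; apply/val_inj/funext. Qed.

Lemma boundedOp_sumE n (F : 'I_n -> boundedOp X) x :
  (\sum_(i < n) F i) x = \sum_(i < n) F i x.
Proof. exact: (big_morph (fun T : boundedOp X => T x)). Qed.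

(** A bound that is not a nonnegative real is possible only on the zero space,
    where 0 does as well. Nonnegativity is what allows bounds to be
    composed. *)
Lemma bound_ge0 (V : normedZmodType K) (h : X -> V) :
  (exists M, forall x, `|h x| <= M * `|x|) ->
  exists2 M, 0 <= M & forall x, `|h x| <= M * `|x|.
Proof.
move=> [M hM]; have [[x x0]|X0] := pselect (exists x : X, x != 0).
  exists M => //; rewrite -(@pmulr_lge0 _ `|x|) ?normr_gt0//.
  exact: le_trans (hM x).
exists 0 => // x; have := hM x; suff -> : x = 0 by rewrite normr0 !mulr0.
by apply/eqP/negPn/negP => x0; apply: X0; exists x.
Qed.

Lemma functional_comp_scalar f T : scalar (f \o T).
Proof. by move=> a x y /=; rewrite !linearP. Qed.

Lemma functional_comp_bounded f T :
  exists M, forall x, `|(f \o T) x| <= M * `|x|.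
Proof.
have [M M0 fM] := bound_ge0 (functional_bounded f).
have /is_bounded_linearP[_ [N TN]] := valP T.
exists (M * N) => x; apply: le_trans (fM _) _.
by rewrite -mulrA; apply: ler_wpM2l => //; exact: TN.
Qed.

Definition functional_comp f T : functional X :=
  Functional (functional_comp_scalar f T) (functional_comp_bounded f T).

Lemma rank1_bounded_linear x f :
  (fun y => f y *: x) \in @is_bounded_linear K X.
Proof.
apply/is_bounded_linearP; split=> [a y z|].
  by rewrite linearP scalerDl scalerA.
have [M fM] := functional_bounded f.
by exists (M * `|x|) => y; rewrite normrZ mulrAC ler_wpM2r.
Qed.

Definition rank1 x f : boundedOp X := BoundedOp (rank1_bounded_linear x f).

Definition tensor n (u : 'I_n -> X) (f : 'I_n -> functional X) : boundedOp X :=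
  \sum_(i < n) rank1 (u i) (f i).

Lemma tensorE n (u : 'I_n -> X) (f : 'I_n -> functional X) x :
  tensor u f x = \sum_(i < n) f i x *: u i.
Proof. exact: boundedOp_sumE. Qed.

Lemma mul_tensorl n T (u : 'I_n -> X) (f : 'I_n -> functional X) :
  T * tensor u f = tensor (T \o u) f.
Proof.
apply: boundedOp_ext => x; rewrite boundedOp_mulE !tensorE linear_sum.
by apply: eq_bigr => i _; rewrite linearZ.
Qed.

Lemma mul_tensorr n T (u : 'I_n -> X) (f : 'I_n -> functional X) :
  tensor u f * T = tensor u (fun i => functional_comp (f i) T).
Proof. by apply: boundedOp_ext => x; rewrite boundedOp_mulE !tensorE. Qed.

Lemma tensor_eq0l n (u : 'I_n -> X) (f : 'I_n -> functional X) T :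
  (forall i, T (u i) = 0) -> T * tensor u f = 0.
Proof.
move=> Tu; apply: boundedOp_ext => x; rewrite mul_tensorl tensorE big1// => i _.
by rewrite /= Tu scaler0.
Qed.

Lemma tensor_eq0r n (u : 'I_n -> X) (f : 'I_n -> functional X) T :
  (forall i x, f i (T x) = 0) -> tensor u f * T = 0.
Proof.
move=> fT; apply: boundedOp_ext => x; rewrite boundedOp_mulE tensorE big1//.
by move=> i _; rewrite fT scale0r.
Qed.

(** Biorthogonality makes [tensor u f] the projection onto the span of the [u i]
    along the common kernel of the [f i]. *)
Definition biorthogonal n (u : 'I_n -> X) (f : 'I_n -> functional X) :=
  forall i j, f i (u j) = (i == j)%:R.

Lemma biorthogonal_comp m n (s : 'I_m -> 'I_n) (u : 'I_n -> X)
    (f : 'I_n -> functional X) :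
  injective s -> biorthogonal u f -> biorthogonal (u \o s) (f \o s).
Proof. by move=> s_inj uf i j; rewrite /= uf (inj_eq s_inj). Qed.

Lemma biorthogonal_tensor n (u : 'I_n -> X) (f : 'I_n -> functional X) j :
  biorthogonal u f -> tensor u f (u j) = u j.
Proof.
move=> uf; rewrite tensorE (bigD1 j)//= uf eqxx scale1r big1 ?addr0// => i ij.
by rewrite uf (negbTE ij) scale0r.
Qed.

Lemma biorthogonal_coord n (u : 'I_n -> X) (f : 'I_n -> functional X) a i :
  biorthogonal u f -> f i (\sum_(j < n) a j *: u j) = a i.
Proof.
move=> uf; rewrite linear_sum (bigD1 i)//= linearZ/= uf eqxx mulr1.
rewrite big1 ?addr0// => j ji.
by rewrite linearZ/= uf eq_sym (negbTE ji) mulr0.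
Qed.

Lemma biorthogonal_tensorr n (u : 'I_n -> X) (f : 'I_n -> functional X) i x :
  biorthogonal u f -> f i (tensor u f x) = f i x.
Proof. by move=> uf; rewrite tensorE biorthogonal_coord. Qed.

End finite_rank.

Definition fcons A n (a : A) (u : 'I_n -> A) (i : 'I_n.+1) : A :=
  if unlift ord0 i is Some j then u j else a.

Lemma fcons0 A n (a : A) (u : 'I_n -> A) : fcons a u ord0 = a.
Proof. by rewrite /fcons unlift_none. Qed.

Lemma fconsS A n (a : A) (u : 'I_n -> A) i : fcons a u (lift ord0 i) = u i.
Proof. by rewrite /fcons liftK. Qed.

Lemma comp_fcons A B n (h : A -> B) (a : A) (u : 'I_n -> A) :
  h \o fcons a u = fcons (h a) (h \o u).
Proof. by apply/funext => i /=; rewrite /fcons; case: unlift. Qed.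

Section biorthogonal_systems.
Context {R : realType} {X : normedModType R[i]}.
Implicit Types (S T : boundedOp X) (x y w : X).

(** Gram-Schmidt for biorthogonal systems. Replacing [w] by its component
    outside the span of [u] keeps the old functionals dual to the enlarged
    family, and composing a functional normed at that component with
    [1 - tensor u f] makes the new functional vanish on [u]. *)
Lemma biorthogonal_extend n (u : 'I_n -> X) (f : 'I_n -> functional X) w :
  biorthogonal u f -> tensor u f w != w ->
  exists g, let u' := fcons (w - tensor u f w) u in let f' := fcons g f in
    [/\ biorthogonal u' f', tensor u' f' w = w &
        forall x, tensor u f x = x -> tensor u' f' x = x].
Proof.
move=> uf Ew; set E := tensor u f.
have [h hw] : exists h : functional X, h (w - E w) = 1.
  by apply: norming_functional; rewrite subr_eq0 eq_sym.
pose g := functional_comp h (1 - E).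
have gE x : g x = h (x - E x) by [].
have g_fix x : E x = x -> g x = 0 by move=> Ex; rewrite gE Ex subrr linear0.
exists g => u' f'.
have E'E x : tensor u' f' x = g x *: (w - E w) + E x.
  rewrite tensorE big_ord_recl /u' /f' !fcons0; congr (_ + _).
  rewrite [RHS]tensorE.
  by apply: eq_bigr => i _; rewrite !fconsS.
split=> [i j||x Ex].
- rewrite /u' /f'; case: (unliftP ord0 i) => [i' ->|->];
    case: (unliftP ord0 j) => [j' ->|->]; rewrite ?fconsS ?fcons0.
  + by rewrite uf (inj_eq (@lift_inj _ ord0)).
  + by rewrite linearB/= /E biorthogonal_tensorr// subrr.
  + by rewrite g_fix// biorthogonal_tensor.
  + suff Ew' : E (w - E w) = 0 by rewrite eqxx gE Ew' subr0 hw.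
    apply/eqP; rewrite linearB/= subr_eq0 eq_sym; apply/eqP.
    rewrite -[E (E w)]/((E * E) w) mul_tensorl !tensorE.
    by apply: eq_bigr => i' _ /=; rewrite biorthogonal_tensor.
- by rewrite E'E gE hw scale1r subrK.
- by rewrite E'E g_fix// scale0r add0r.
Qed.

Lemma biorthogonal_fixing (s : seq X) :
  exists n (u : 'I_n -> X) (f : 'I_n -> functional X),
    biorthogonal u f /\ {in s, forall x, tensor u f x = x}.
Proof.
elim: s => [|w s [n [u [f [uf fs]]]]].
  have [u f] : ('I_0 -> X) * ('I_0 -> functional X) by split; case.
  by exists 0%N, u, f; split=> [[]|].
have [Ew|Ew] := eqVneq (tensor u f w) w.
  by exists n, u, f; split=> // x; rewrite inE => /predU1P[->//|/fs].
have [g /= [uf' Ew' Es']] := biorthogonal_extend uf Ew.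
exists n.+1, (fcons (w - tensor u f w) u), (fcons g f); split=> // x.
by rewrite inE => /predU1P[->//|/fs/Es'].
Qed.

(** The alternative between rank at least [n] and finite rank. The vectors are
    kept as images under [T], so that the functionals composed with [T] are dual
    to the chosen preimages. *)
Lemma biorthogonal_range T n :
  (exists (x : 'I_n -> X) (f : 'I_n -> functional X),
     biorthogonal (T \o x) f) \/
  (exists m (x : 'I_m -> X) (f : 'I_m -> functional X),
     tensor (T \o x) f * T = T).
Proof.
elim: n => [|n [[x [f xf]]|]]; [|..|by right].
  have [x f] : ('I_0 -> X) * ('I_0 -> functional X) by split; case.
  by left; exists x, f; case.
have [ET|/existsNP[y /eqP ETy]] :=
    pselect (forall y, tensor (T \o x) f (T y) = T y).
  by right; exists n, x, f; apply: boundedOp_ext => y; exact: ET.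
have [g /= [xf' _ _]] := biorthogonal_extend xf ETy.
left; exists (fcons (y - tensor x f (T y)) x), (fcons g f).
rewrite comp_fcons linearB/=.
by rewrite -(boundedOp_mulE T (tensor x f)) mul_tensorl.
Qed.

(** A biorthogonal system whose projection fixes all the [u i] and [v i] has the
    identity as projection, so it is a finite basis of the space. *)
Lemma infinite_dimensional_tensor : infinite_dimensional X ->
  forall m (u : 'I_m -> X) f n (v : 'I_n -> X) g,
  tensor u f + tensor v g <> 1.
Proof.
move=> infX m u f n v g uv1; apply: infX.
have [k [w [h [wh fixE]]]] := biorthogonal_fixing (codom u ++ codom v).
exists k, w; split=> [a a0 i|].
  by rewrite -(biorthogonal_coord a i wh) a0 linear0.
have E1 : tensor w h = 1.
  rewrite -[LHS]mulr1 -uv1 mulrDr !mul_tensorl; congr (_ + _).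
    by congr tensor; apply/funext => i /=; rewrite fixE// mem_cat codom_f.
  by congr tensor; apply/funext => i /=; rewrite fixE// mem_cat codom_f orbT.
apply/seteqP; split=> // x _; exists (fun i => h i x) => //.
by rewrite -tensorE E1.
Qed.

Lemma has_rank_factor C k : has_rank C k ->
  exists n (e : 'I_n -> X) h, tensor e h * C = C.
Proof.
move=> [e [_ Ce]]; have [n [u [f [_ fixE]]]] := biorthogonal_fixing (codom e).
exists n, u, f; apply: boundedOp_ext => x; rewrite boundedOp_mulE.
have : range C (C x) by exists x.
rewrite Ce => -[a _ <-]; rewrite linear_sum; apply: eq_bigr => i _.
by rewrite linearZ/= fixE// codom_f.
Qed.

End biorthogonal_systems.

(** * Zero products *)

Section zero_product.
Context {R : realType} {X : normedModType R[i]}.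
Context {F : comNzRingType} {A : lmodType F} {mul : {bilinear A -> A -> A}}.
Context {C : boundedOp X} {D : A} {phi : {additive boundedOp X -> A}}.
Implicit Types Q P S T : boundedOp X.
Hypothesis phiD :
  forall S T : boundedOp X, S * T = C -> mul (phi S) (phi T) = D.

(** [S * T], [S * (T + P)], [(S + Q) * T] and [(S + Q) * (T + P)] are all equal
    to [C]. *)
Lemma zero_product_of_factorization Q P S T :
  S * T = C -> S * P = 0 -> Q * T = 0 -> Q * P = 0 -> mul (phi Q) (phi P) = 0.
Proof.
move=> ST SP QT QP; have STD := phiD ST.
have SP0 : mul (phi S) (phi P) = 0.
  have /phiD : S * (T + P) = C by rewrite mulrDr ST SP addr0.
  by rewrite (raddfD phi) linearDr STD -[RHS]addr0 => /addrI.
have QT0 : mul (phi Q) (phi T) = 0.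
  have /phiD : (S + Q) * T = C by rewrite mulrDl ST QT addr0.
  by rewrite (raddfD phi) linearDl STD -[RHS]addr0 => /addrI.
have /phiD : (S + Q) * (T + P) = C.
  by rewrite mulrDl !mulrDr ST SP QT QP !addr0.
rewrite !(raddfD phi) linearDl !linearDr/= STD SP0 QT0 addr0 add0r.
by rewrite -[RHS]addr0 => /addrI.
Qed.

(** The factors are [tensor e f], which kills ran [P] with [f], and
    [tensor u h * C], whose range lies in ker [Q]; duality of [u] and [f]
    contracts their product to [tensor e h * C]. *)
Lemma zero_product_of_biorthogonal n (e : 'I_n -> X) h
    (u : 'I_n -> X) (f : 'I_n -> functional X) Q P :
  tensor e h * C = C -> biorthogonal u f ->
  (forall i, Q (u i) = 0) -> (forall i x, f i (P x) = 0) -> Q * P = 0 ->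
  mul (phi Q) (phi P) = 0.
Proof.
move=> ehC uf Qu fP.
apply: (@zero_product_of_factorization _ _ (tensor e f) (tensor u h * C)).
- rewrite mulrA mul_tensorl -[RHS]ehC; congr (tensor _ _ * _).
  apply/funext => j /=; rewrite tensorE (bigD1 j)//= uf eqxx scale1r.
  by rewrite big1 ?addr0// => i ij; rewrite uf (negbTE ij) scale0r.
- exact: tensor_eq0r.
- by rewrite mulrA tensor_eq0l// mul0r.
Qed.

(** Cut [Q] along the idempotent [E] of the first half of the system: the first
    half of the vectors is killed by [Q * (1 - E)], the second half by
    [Q * E]. *)
Lemma zero_product_of_annihilators n (e : 'I_n -> X) h
    (u : 'I_(n + n) -> X) (f : 'I_(n + n) -> functional X) Q P :
  tensor e h * C = C -> biorthogonal u f ->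
  (forall i x, f i (P x) = 0) -> Q * P = 0 -> mul (phi Q) (phi P) = 0.
Proof.
move=> ehC uf fP QP; pose l := @lshift n n; pose r := @rshift n n.
pose E := tensor (u \o l) (f \o l).
have EP : E * P = 0 by apply: tensor_eq0r => i x; exact: fP.
have ul : biorthogonal (u \o l) (f \o l).
  exact: biorthogonal_comp (@lshift_inj _ _) uf.
have ur : biorthogonal (u \o r) (f \o r).
  exact: biorthogonal_comp (@rshift_inj _ _) uf.
have -> : Q = Q * (1 - E) + Q * E by rewrite mulrBr mulr1 subrK.
rewrite (raddfD phi) linearDl.
rewrite (zero_product_of_biorthogonal ehC ul) ?add0r.
- apply: (zero_product_of_biorthogonal ehC ur) => [i|i x|].
  + rewrite boundedOp_mulE tensorE big1 ?linear0// => j _.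
    by rewrite /= uf eq_lrshift scale0r.
  + exact: fP.
  + by rewrite -mulrA EP mulr0.
- move=> i; rewrite boundedOp_mulE.
  rewrite (_ : (1 - E) ((u \o l) i) = 0) ?linear0//.
  by rewrite -[LHS]/((u \o l) i - E ((u \o l) i)) biorthogonal_tensor// subrr.
- by move=> i x; exact: fP.
- by rewrite -mulrA mulrBl mul1r EP subr0.
Qed.

(** Dual to [zero_product_of_annihilators]: cut [P] instead, so that the first
    half of the functionals vanishes on the range of [(1 - E) * P] and the
    second half on that of [E * P]. *)
Lemma zero_product_of_kernel n (e : 'I_n -> X) h
    (u : 'I_(n + n) -> X) (f : 'I_(n + n) -> functional X) Q P :
  tensor e h * C = C -> biorthogonal u f ->
  (forall i, Q (u i) = 0) -> Q * P = 0 -> mul (phi Q) (phi P) = 0.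
Proof.
move=> ehC uf Qu QP; pose l := @lshift n n; pose r := @rshift n n.
pose E := tensor (u \o l) (f \o l).
have QE : Q * E = 0 by apply: tensor_eq0l => i; exact: Qu.
have ul : biorthogonal (u \o l) (f \o l).
  exact: biorthogonal_comp (@lshift_inj _ _) uf.
have ur : biorthogonal (u \o r) (f \o r).
  exact: biorthogonal_comp (@rshift_inj _ _) uf.
have -> : P = (1 - E) * P + E * P by rewrite mulrBl mul1r subrK.
rewrite (raddfD phi) linearDr.
rewrite (zero_product_of_biorthogonal ehC ul) ?add0r.
- apply: (zero_product_of_biorthogonal ehC ur) => [i|i x|].
  + exact: Qu.
  + rewrite boundedOp_mulE tensorE linear_sum big1// => j _.
    by rewrite linearZ/= uf eq_rlshift mulr0.
  + by rewrite mulrA QE mul0r.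
- by move=> i; exact: Qu.
- move=> i x; rewrite boundedOp_mulE -[(1 - E) _]/(P x - E (P x)).
  by rewrite linearB/= (biorthogonal_tensorr _ _ ul) subrr.
- by rewrite mulrA mulrBr mulr1 QE subr0.
Qed.

End zero_product.

(** * Zero products are preserved *)

Theorem proposition2p1 (R : realType) (X : completeNormedModType R[i])
    (F : comNzRingType) (A : lmodType F) (mul : {bilinear A -> A -> A})
    (mulA : associative mul)
    (infX : infinite_dimensional X)
    (k : nat) (C : boundedOp X) (rankC : has_rank C k) (D : A)
    (phi : {additive boundedOp X -> A})
    (phiD : forall S T : boundedOp X, S * T = C -> mul (phi S) (phi T) = D) :
  forall Q P : boundedOp X, Q * P = 0 -> mul (phi Q) (phi P) = 0.
Proof.
move=> Q P QP; have [n [e [h ehC]]] := has_rank_factor rankC.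
have [[x [f xf]]|[m [x [f QxfQ]]]] := biorthogonal_range Q (n + n).
  apply: (zero_product_of_annihilators phiD ehC (u := x)
            (f := fun i => functional_comp (f i) Q)) => // i y.
  by rewrite -[LHS]/(f i ((Q * P) y)) QP linear0.
(* [Q] has finite rank: [T] is of finite rank with [Q * T = Q], so the range of
   [1 - T] is contained in ker [Q]. *)
pose T := tensor x (fun i => functional_comp (f i) Q).
have QT : Q * T = Q by rewrite -[RHS]QxfQ mul_tensorr mul_tensorl.
have [[y [g yg]]|[m' [y [g TygT]]]] := biorthogonal_range (1 - T) (n + n).
  apply: (zero_product_of_kernel phiD ehC yg) => // i.
  by rewrite -[LHS]/((Q * (1 - T)) (y i)) mulrBr QT mulr1 subrr.
(* If [1 - T] had finite rank as well, so would the identity. *)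
case: (infinite_dimensional_tensor infX (u := x)
  (f := fun i => functional_comp (f i) Q) (v := (1 - T) \o y)
  (g := fun i => functional_comp (g i) (1 - T))).
by rewrite -(mul_tensorr (1 - T)) TygT addrC subrK.
Qed.
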